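(* The category $\mathbf{KBSob}$ of all $k$-bounded sober spaces and continuous mappings is not a reflective subcategory of the category $\mathbf{Top}_k$ of all $T_0$ spaces and continuous mappings preserving existing irreducible suprema.
   Context: For a $T_0$ space $X$ the specialization order is the partial order $x\le y$ iff $x\in \mathrm{cl}(\{y\})$; all suprema $\bigvee$ in $X$ are taken with respect to this order. A non-empty subset $F$ of a topological space $X$ is irreducible if whenever $F\subseteq A\cup B$ with $A,B$ closed in $X$, then $F\subseteq A$ or $F\subseteq B$. A $T_0$ space $X$ is $k$-bounded sober if for every irreducible closed subset $F$ of $X$ whose supremum $\bigvee F$ exists, there is a unique point $x\in X$ with $F=\mathrm{cl}(\{x\})$. A mapping $f:X\to Y$ between $T_0$ spaces preserves existing irreducible suprema if for each irreducible subset $F$ of $X$ for which $\bigvee F$ exists, $f(\bigvee F)=\bigvee f(F)$ (in particular the right-hand supremum exists). Every continuous mapping between $k$-bounded sober spaces preserves existing irreducible suprema, so $\mathbf{KBSob}$ is a full subcategory of $\mathbf{Top}_k$. A subcategory $\mathbf A$ of a category $\mathbf B$ is reflective if for every object $B$ of $\mathbf B$ there are an object $\overline B$ of $\mathbf A$ and a $\mathbf B$-morphism $r:B\to\overline B$ such that for every $\mathbf B$-morphism $f:B\to A$ with $A$ an object of $\mathbf A$ there is a unique $\mathbf A$-morphism $\bar f:\overline B\to A$ with $\bar f\circ r=f$. *)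

(* Defs.v *)
From HB Require Import structures.
From mathcomp Require Import all_boot.
From mathcomp Require Import boolp classical_sets topology separation_axioms.

Set Implicit Arguments.
Unset Strict Implicit.
Unset Printing Implicit Defensive.

Local Open Scope classical_set_scope.

Record category := Category {
  obj :> Type;
  hom : obj -> obj -> Type;
  idm : forall X, hom X X;
  catcomp : forall X Y Z, hom Y Z -> hom X Y -> hom X Z;
  comp_idl : forall X Y (f : hom X Y), catcomp (idm Y) f = f;
  comp_idr : forall X Y (f : hom X Y), catcomp f (idm X) = f;
  comp_assoc : forall W X Y Z (h : hom Y Z) (g : hom X Y) (f : hom W X),
    catcomp h (catcomp g f) = catcomp (catcomp h g) f
}.

(* A subcategory is given by its inclusion functor, which is injective on
   objects and on morphisms but need not be full. *)
Record subcategory (A B : category) := Subcategory {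
  inc_obj :> A -> B;
  inc_hom : forall X Y : A, hom X Y -> hom (inc_obj X) (inc_obj Y);
  inc_obj_inj : injective inc_obj;
  inc_hom_inj : forall X Y : A, injective (@inc_hom X Y);
  inc_idm : forall X : A, inc_hom (idm X) = idm (inc_obj X);
  inc_comp : forall (X Y Z : A) (g : hom Y Z) (f : hom X Y),
    inc_hom (catcomp g f) = catcomp (inc_hom g) (inc_hom f)
}.

Definition full (A B : category) (I : subcategory A B) :=
  forall (X Y : A) (f : hom (I X) (I Y)), exists g : hom X Y, inc_hom I g = f.

Definition reflective (A B : category) (I : subcategory A B) :=
  forall X : B, exists (Y : A) (r : hom X (I Y)),
    forall (Z : A) (f : hom X (I Z)),
      exists! g : hom Y Z, catcomp (inc_hom I g) r = f.

Section Spaces.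
Context {X : topologicalType}.

Definition specialization (x y : X) := closure [set y] x.

Definition is_supremum (F : set X) (m : X) :=
  (forall x, F x -> specialization x m) /\
  (forall u, (forall x, F x -> specialization x u) -> specialization m u).

Definition irreducible_set (F : set X) :=
  F !=set0 /\
  forall A B : set X, closed A -> closed B ->
    F `<=` A `|` B -> F `<=` A \/ F `<=` B.

End Spaces.

Definition kbounded_sober (X : topologicalType) :=
  kolmogorov_space X /\
  forall F : set X, irreducible_set F -> closed F ->
    (exists m, is_supremum F m) -> exists! x : X, F = closure [set x].

Definition preserves_irr_sup (X Y : topologicalType) (f : X -> Y) :=
  forall (F : set X) (m : X),
    irreducible_set F -> is_supremum F m -> is_supremum (f @` F) (f m).

Lemma specialization_closed (X : topologicalType) (C : set X) (x y : X) :
  closed C -> C y -> specialization x y -> C x.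
Proof.
by move=> cC Cy xy; apply: cC; apply: closureS xy => _ ->.
Qed.

Lemma closed_specialization (X : topologicalType) (y : X) :
  closed [set x : X | specialization x y].
Proof. exact: closed_closure. Qed.

Lemma irreducible_image (X Y : topologicalType) (f : X -> Y) (F : set X) :
  continuous f -> irreducible_set F -> irreducible_set (f @` F).
Proof.
move=> /continuous_closedP cf [[x Fx] irrF]; split; first by exists (f x), x.
move=> A B cA cB fFAB.
have [||x' Fx'|FA|FB] := irrF (f @^-1` A) (f @^-1` B).
- exact: cf.
- exact: cf.
- by apply: fFAB; exists x'.
- by left=> _ [z Fz <-]; exact: FA.
- by right=> _ [z Fz <-]; exact: FB.
Qed.

Lemma irreducible_closure (X : topologicalType) (F : set X) :
  irreducible_set F -> irreducible_set (closure F).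
Proof.
move=> [[x Fx] irrF]; split; first by exists x; exact: subset_closure.
move=> A B cA cB FAB.
have [//|//|z Fz|FA|FB] := irrF A B.
- by apply: FAB; exact: subset_closure.
- by left; rewrite (closure_id A).1//; exact: closureS.
- by right; rewrite (closure_id B).1//; exact: closureS.
Qed.

Lemma is_supremum_closure (X : topologicalType) (F : set X) (m : X) :
  is_supremum F m -> is_supremum (closure F) m.
Proof.
move=> [ubm lem]; split=> [x Fx|u ubu]; last first.
  by apply: lem => x Fx; apply: ubu; exact: subset_closure.
have := closureS (B := [set x | specialization x m]) ubm Fx.
by rewrite -(closure_id _).1//; exact: closed_specialization.
Qed.

Lemma kbounded_sober_continuous (X Y : topologicalType) (f : X -> Y) :
  kbounded_sober X -> continuous f -> preserves_irr_sup f.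
Proof.
move=> [_ sobX] /continuous_closedP cf F m irrF supF.
have [x [clFx _]] : exists! x, closure F = closure [set x].
  apply: sobX; [exact: irreducible_closure|exact: closed_closure|].
  by exists m; exact: is_supremum_closure.
have [ubm lem] := supF.
have mono u v : specialization u v -> specialization (f u) (f v).
  move=> uv.
  have cv : closed (f @^-1` closure [set f v]) by apply: cf; exact: closed_closure.
  by apply: specialization_closed cv _ uv; exact: subset_closure.
have mx : specialization m x.
  by apply: lem => z Fz; rewrite /specialization -clFx; exact: subset_closure.
split=> [_ [z Fz <-]|u ubu]; first exact/mono/ubm.
apply: specialization_closed (@closed_closure _ _) _ (mono _ _ mx).
have cu : closed (f @^-1` closure [set u]).
  by apply: cf; exact: closed_closure.
suff : closure F `<=` f @^-1` closure [set u].
  by apply; rewrite clFx; exact: subset_closure.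
rewrite [X in _ `<=` X](closure_id _).1//; apply: closureS => z Fz.
by apply: ubu; exists z.
Qed.

Lemma sval_inj (T : Type) (P : T -> Prop) : injective (@sval T P).
Proof. by move=> [x px] [y py] /= xy; exact: eq_exist. Qed.

Section Topk.

Definition topk_obj := {X : topologicalType | kolmogorov_space X}.

Definition topk_hom (X Y : topk_obj) :=
  {f : sval X -> sval Y | continuous f /\ preserves_irr_sup f}.

Lemma topk_idm_subproof (X : topk_obj) :
  continuous (@id (sval X)) /\ preserves_irr_sup (@id (sval X)).
Proof. by split=> [x|F m _]; [exact: cvg_id|rewrite image_id]. Qed.

Definition topk_idm (X : topk_obj) : topk_hom X X :=
  exist _ _ (topk_idm_subproof X).

Lemma topk_comp_subproof (X Y Z : topk_obj)
    (g : topk_hom Y Z) (f : topk_hom X Y) :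
  continuous (sval g \o sval f) /\ preserves_irr_sup (sval g \o sval f).
Proof.
case: f g => [f [cf pf]] [g [cg pg]] /=; split.
  by move=> x; apply: continuous_comp; [exact: cf|exact: cg].
move=> F m irrF supF; rewrite -image_comp.
by apply: pg; [exact: irreducible_image|exact: pf].
Qed.

Definition topk_comp (X Y Z : topk_obj)
    (g : topk_hom Y Z) (f : topk_hom X Y) : topk_hom X Z :=
  exist _ _ (topk_comp_subproof g f).

Lemma topk_comp_idl (X Y : topk_obj) (f : topk_hom X Y) :
  topk_comp (topk_idm Y) f = f.
Proof. exact: sval_inj. Qed.

Lemma topk_comp_idr (X Y : topk_obj) (f : topk_hom X Y) :
  topk_comp f (topk_idm X) = f.
Proof. exact: sval_inj. Qed.

Lemma topk_comp_assoc (W X Y Z : topk_obj)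
    (h : topk_hom Y Z) (g : topk_hom X Y) (f : topk_hom W X) :
  topk_comp h (topk_comp g f) = topk_comp (topk_comp h g) f.
Proof. exact: sval_inj. Qed.

Definition Topk : category :=
  Category topk_comp_idl topk_comp_idr topk_comp_assoc.

End Topk.

Section KBSob.

Definition kbsob_obj := {X : topologicalType | kbounded_sober X}.

Definition kbsob_hom (X Y : kbsob_obj) :=
  {f : sval X -> sval Y | continuous f}.

Definition kbsob_idm (X : kbsob_obj) : kbsob_hom X X :=
  exist _ _ (topk_idm_subproof (exist _ _ (svalP X).1)).1.

Lemma kbsob_comp_subproof (X Y Z : kbsob_obj)
    (g : kbsob_hom Y Z) (f : kbsob_hom X Y) :
  continuous (sval g \o sval f).
Proof.
case: f g => [f cf] [g cg] x /=.
by apply: continuous_comp; [exact: cf|exact: cg].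
Qed.

Definition kbsob_comp (X Y Z : kbsob_obj)
    (g : kbsob_hom Y Z) (f : kbsob_hom X Y) : kbsob_hom X Z :=
  exist _ _ (@kbsob_comp_subproof X Y Z g f).

Lemma kbsob_comp_idl (X Y : kbsob_obj) (f : kbsob_hom X Y) :
  kbsob_comp (kbsob_idm Y) f = f.
Proof. exact: sval_inj. Qed.

Lemma kbsob_comp_idr (X Y : kbsob_obj) (f : kbsob_hom X Y) :
  kbsob_comp f (kbsob_idm X) = f.
Proof. exact: sval_inj. Qed.

Lemma kbsob_comp_assoc (W X Y Z : kbsob_obj)
    (h : kbsob_hom Y Z) (g : kbsob_hom X Y) (f : kbsob_hom W X) :
  kbsob_comp h (kbsob_comp g f) = kbsob_comp (kbsob_comp h g) f.
Proof. exact: sval_inj. Qed.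

Definition KBSob : category :=
  Category kbsob_comp_idl kbsob_comp_idr kbsob_comp_assoc.

End KBSob.

Section Inclusion.

Definition kbsob_topk_obj (X : KBSob) : Topk := exist _ (sval X) (svalP X).1.

Definition kbsob_topk_hom (X Y : KBSob) (f : hom X Y) :
    hom (kbsob_topk_obj X) (kbsob_topk_obj Y) :=
  exist _ (sval f)
    (conj (svalP f) (kbounded_sober_continuous (svalP X) (svalP f))).

Lemma kbsob_topk_obj_inj : injective kbsob_topk_obj.
Proof. by move=> X Y /(congr1 sval) /= XY; exact: sval_inj. Qed.

Lemma kbsob_topk_hom_inj (X Y : KBSob) : injective (@kbsob_topk_hom X Y).
Proof. by move=> f g /(congr1 sval) /= fg; exact: sval_inj. Qed.

Lemma kbsob_topk_idm (X : KBSob) :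
  kbsob_topk_hom (idm X) = idm (kbsob_topk_obj X).
Proof. exact: sval_inj. Qed.

Lemma kbsob_topk_comp (X Y Z : KBSob) (g : hom Y Z) (f : hom X Y) :
  kbsob_topk_hom (catcomp g f) = catcomp (kbsob_topk_hom g) (kbsob_topk_hom f).
Proof. exact: sval_inj. Qed.

Definition KBSob_Topk : subcategory KBSob Topk :=
  Subcategory kbsob_topk_obj_inj kbsob_topk_hom_inj
    kbsob_topk_idm kbsob_topk_comp.

Lemma KBSob_Topk_full : full KBSob_Topk.
Proof.
by move=> X Y [f [cf pf]]; exists (exist _ f cf); exact: sval_inj.
Qed.

End Inclusion.

(* Main.v *)
(* Let F be a disjoint union of chains (i, 0) < (i, 1) < ... with suprema s_i.
   Give F + {top} a topology X for which F is not irreducible but every closed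
   set containing infinitely many s_i contains all the (i, n). Let X' be the
   coarsening of X by the closed sets that are stable under suprema of chains:
   there F is a closed irreducible set with supremum top and no generic point.
   Every morphism from X to a k-bounded sober space is continuous on X'. Adding
   to X' two more upper bounds of F destroys the supremum of F and yields a
   k-bounded sober space Z, into which X includes as a morphism. If r : X -> Y
   is a reflection, the inclusion extends to g : Y -> Z, and uniqueness, applied
   to the automorphism of Z swapping the two new points, shows that g takes
   values in X; then r g : Y -> Y is continuous because r is continuous on X',
   so r g = id by uniqueness again. Hence Y is homeomorphic to X', which is not
   k-bounded sober. *)
Require Import Defs.
From HB Require Import structures.
From mathcomp Require Import all_boot.
From mathcomp Require Import boolp classical_sets topology separation_axioms.

Set Implicit Arguments.
Unset Strict Implicit.
Unset Printing Implicit Defensive.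

Local Open Scope classical_set_scope.

(** * Unbounded index sets and the specialization order *)

Definition unbounded (P : set nat) := forall k, exists2 n, k <= n & P n.

Lemma unboundedS (P Q : set nat) : P `<=` Q -> unbounded P -> unbounded Q.
Proof. by move=> PQ uP k; have [n kn /PQ] := uP k; exists n. Qed.

Lemma unboundedU (P Q : set nat) :
  unbounded (P `|` Q) -> unbounded P \/ unbounded Q.
Proof.
move=> uPQ; have [uP|/existsNP[k Pk]] := pselect (unbounded P); first by left.
right=> l; have [n + [Pn|Qn]] := uPQ (maxn k l); rewrite geq_max => /andP[kn ln].
  by exfalso; apply: Pk; exists n.
by exists n.
Qed.

Lemma specialization_anti_kolmogorov (X : topologicalType) :
  (forall x y : X, specialization x y -> specialization y x -> x = y) ->
  kolmogorov_space X.
Proof.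
move=> anti x y; apply: contra_neqP => nA.
have clP (u v : X) : ~ specialization u v -> nbhs u (~` closure [set v]).
  by move=> nuv; apply: open_nbhs_nbhs; split=> //; exact/closed_openC/closed_closure.
apply: anti; apply: contrapT => nxy; apply: nA.
- exists (~` closure [set y]); left; split; rewrite inE; first exact: clP.
  by apply; exact: subset_closure.
- exists (~` closure [set x]); right; split; rewrite inE; first exact: clP.
  by apply; exact: subset_closure.
Qed.

Lemma continuous_specialization (X Y : topologicalType) (f : X -> Y) (x y : X) :
  continuous f -> specialization x y -> specialization (f x) (f y).
Proof.
move=> /continuous_closedP cf.
apply: (specialization_closed (C := f @^-1` closure [set f y])).
  by apply: cf; exact: closed_closure.
exact: subset_closure.
Qed.

(** * The comb spaces and their order *)

(** The phantom flag [s] puts the two topologies on separate types with convertible points, so one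
    function can be read on either. *)
Definition comb (s : bool) (T : choiceType) : Type := (nat * option nat + T)%type.

(* inl (i, Some n) is the n-th point of the i-th chain, inl (i, None) its
   supremum s_i, and inr t an upper bound of all the chains. The flag s asks for
   stability under suprema of chains. With the header's notation,
   X = comb false unit, X' = comb true unit and Z = comb true (option bool). *)
Definition comb_closed (s : bool) (T : choiceType) (A : set (comb s T)) :=
  [/\ forall i n, A (inl (i, Some n)) ->
        forall m, m <= n -> A (inl (i, Some m)),
      forall i, A (inl (i, None)) -> forall n, A (inl (i, Some n)),
      s -> forall i, (forall n, A (inl (i, Some n))) -> A (inl (i, None)),
      unbounded [set i | A (inl (i, None))] ->
        forall i n, A (inl (i, Some n))
    & forall t, A (inr t) -> forall p, A (inl p)].

Section Comb.
Context {s : bool} {T : choiceType}.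
Local Notation K := (comb s T).
Implicit Types A B : set K.

Lemma comb_closed0 : comb_closed (set0 : set K).
Proof.
split; [by []|by []|by move=> _ i /(_ 0)| |by []].
by move=> /(_ 0)[].
Qed.

Lemma comb_closedU A B : comb_closed A -> comb_closed B -> comb_closed (A `|` B).
Proof.
move=> [A1 A2 A3 A4 A5] [B1 B2 B3 B4 B5]; split.
- by move=> i n [/A1 An|/B1 Bn] m mn; [left; exact: An|right; exact: Bn].
- by move=> i [/A2 An|/B2 Bn] n; [left|right].
- move=> hs i ABi.
  (* One of the two sets meets the chain in infinitely many points, hence contains all of it by
     down-closure. *)
  have [n|uA|uB] := @unboundedU [set n | A (inl (i, Some n))]
    [set n | B (inl (i, Some n))]; first by exists n => //; exact: ABi.
    by left; apply: A3 => // n; have [m nm /A1] := uA n; apply.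
  by right; apply: B3 => // n; have [m nm /B1] := uB n; apply.
- by move=> /unboundedU[/A4 An|/B4 Bn] i n; [left|right].
- by move=> t [/A5 At|/B5 Bt] p; [left|right].
Qed.

Lemma comb_closed_bigcap (I : Type) (f : I -> set K) :
  (forall i, comb_closed (f i)) -> comb_closed (\bigcap_i f i).
Proof.
move=> cf; split.
- by move=> i n fn m mn j _; have [f1 _ _ _ _] := cf j; apply: f1 mn; exact: fn.
- by move=> i fi n j _; have [_ f2 _ _ _] := cf j; apply: f2; exact: fi.
- move=> hs i fi j _; have [_ _ f3 _ _] := cf j.
  by apply: f3 => // n; exact: fi.
- move=> uf i n j _; have [_ _ _ f4 _] := cf j.
  by apply: f4; apply: unboundedS uf => k; exact.
- by move=> t ft p j _; have [_ _ _ _ f5] := cf j; apply: f5; exact: ft.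
Qed.

Definition comb_open A := comb_closed (~` A).

Lemma comb_openT : comb_open setT.
Proof. by rewrite /comb_open setCT; exact: comb_closed0. Qed.

Lemma comb_openI : setI_closed comb_open.
Proof. by move=> A B; rewrite /comb_open setCI; exact: comb_closedU. Qed.

Lemma comb_open_bigU (I : Type) (f : I -> set K) :
  (forall i, comb_open (f i)) -> comb_open (\bigcup_i f i).
Proof. by rewrite /comb_open setC_bigcup; exact: comb_closed_bigcap. Qed.

HB.instance Definition _ := Choice.on K.
HB.instance Definition _ :=
  isOpenTopological.Build K comb_openT comb_openI comb_open_bigU.

Lemma closed_comb A : closed A <-> comb_closed A.
Proof. by rewrite -openC -[in X in _ <-> X](setCK A). Qed.

Definition comb_le (x y : K) : Prop :=
  match x, y with
  | inl p, inl q => p.1 = q.1 /\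
      if q.2 is Some n then (if p.2 is Some m then m <= n else false) else true
  | inl _, inr _ => True
  | inr t, inr u => t = u
  | inr _, inl _ => False
  end.

Lemma comb_le_refl x : comb_le x x.
Proof. by case: x => [[i [n|]]|t] /=. Qed.

Lemma comb_le_closed A x y : comb_closed A -> comb_le x y -> A y -> A x.
Proof.
move=> [A1 A2 _ _ A5]; case: x y => [[i a]|t] [[j b]|u] //=; last first.
- by move=> ->.
- by move=> _ /A5.
case=> ->; case: a b => [m|] [n|] //= mn Ay; first exact: A1 mn.
exact: A2.
Qed.

(** The down-set of an [inl] point contains at most one [s_i], so the clause on infinitely many
    suprema is vacuous there. *)
Lemma comb_down_closed y : comb_closed [set x | comb_le x y].
Proof.
case: y => [[j [k|]]|u]; split => //=.
- by move=> i n [-> nk] m mn; split=> //; exact: leq_trans nk.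
- by move=> i [].
- by move=> _ i /(_ k.+1)[]; rewrite ltnn.
- by move=> /(_ 0)[? _ []].
- by move=> _ i /(_ 0)[->].
- by move=> /(_ j.+1)[i + [ij _]]; rewrite ij ltnn.
Qed.

Lemma specialization_comb (x y : K) : specialization x y <-> comb_le x y.
Proof.
split=> [xy|xy].
  apply: (specialization_closed (C := [set x | comb_le x y])) xy.
    exact/closed_comb/comb_down_closed.
  exact: comb_le_refl.
apply: comb_le_closed xy _; last exact: subset_closure.
by apply/closed_comb; exact: closed_closure.
Qed.

Lemma comb_le_anti (x y : K) : comb_le x y -> comb_le y x -> x = y.
Proof.
case: x y => [[i a]|t] [[j b]|u] //=; last by move=> ->.
move=> [-> ab] [_]; case: a b ab => [m|] [n|] //= mn nm.
by rewrite (@anti_leq m n) // mn.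
Qed.

Lemma comb_kolmogorov : kolmogorov_space K.
Proof.
apply: specialization_anti_kolmogorov => x y.
by move=> /specialization_comb xy /specialization_comb; exact: comb_le_anti.
Qed.

Lemma tooth_irreducible i :
  irreducible_set [set x : K | exists n, x = inl (i, Some n)].
Proof.
split; first by exists (inl (i, Some 0)), 0.
move=> A B /closed_comb[A1 _ _ _ _] /closed_comb[B1 _ _ _ _] AB.
have [n|uA|uB] := @unboundedU [set n | A (inl (i, Some n))]
    [set n | B (inl (i, Some n))]; first by exists n => //; apply: AB; exists n.
- by left=> _ [n ->]; have [m nm /A1] := uA n; apply.
- by right=> _ [n ->]; have [m nm /B1] := uB n; apply.
Qed.

Lemma tooth_supremum i :
  is_supremum [set x : K | exists n, x = inl (i, Some n)] (inl (i, None)).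
Proof.
split=> [_ [n ->]|u ubu]; first by apply/specialization_comb.
have {}ubu n : comb_le (inl (i, Some n)) u.
  by apply/specialization_comb/ubu; exists n.
apply/specialization_comb.
case: u ubu => [[j [k|]]|//] ubu; last by have [] := ubu 0.
by have [_] := ubu k.+1; rewrite ltnn.
Qed.

End Comb.

(** * k-bounded sobriety of Z *)

(** The supremum [m] of [C] is the generic point. If [m = inr t] were outside [C], then [C] would
    consist of [inl] points and some other [inr u] would be an upper bound not above [m]. If [m]
    belongs to chain [i] or is its supremum, then [C] either contains [s_i] or is a finite initial
    segment with a greatest element. *)
Lemma comb_kbounded_sober (T : choiceType) :
  (forall t : T, exists u, u <> t) -> kbounded_sober (comb true T).
Proof.
move=> Tnt; split; first exact: comb_kolmogorov.
move=> C [[x0 Cx0] _] cC [m [ubm lem]]; exists m; split; last first.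
  move=> y Cy; apply: comb_le_anti; apply/specialization_comb.
    apply: lem => x; rewrite Cy; exact.
  by apply: ubm; rewrite Cy; exact: subset_closure.
have {}ubm x : C x -> comb_le x m by move=> /ubm/specialization_comb.
have {}lem u : (forall x, C x -> comb_le x u) -> comb_le m u.
  by move=> ubu; apply/specialization_comb/lem => x /ubu/specialization_comb.
have /closed_comb CC := cC; have [C1 C2 C3 C4 C5] := CC.
suff Cm : C m.
  apply/seteqP; split=> x; first by move=> /ubm/specialization_comb.
  by move=> /specialization_comb xm; exact: comb_le_closed xm Cm.
apply: contrapT => nCm; case: m => [[i b]|t] in ubm lem nCm *; last first.
  have [u ut] := Tnt t; apply: ut; apply/esym; apply: (lem (inr u)).
  case=> [//|v Cv]; have /= vt := ubm _ Cv.
  by exfalso; apply: nCm; rewrite -vt.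
have /existsNP[n0 nCn0] : ~ forall n, C (inl (i, Some n)).
  by case: b nCm {ubm lem} => [n nCn /(_ n)|nCi /C3]; [|move=> /(_ isT)].
have : exists n, `[< ~ C (inl (i, Some n)) >] by exists n0; apply/asboolP.
(* [n] is the first index missing from [C]; as [C] is non-empty, [n] is a successor and its
   predecessor gives the greatest element of [C]. *)
move=> /ex_minnP[n /asboolP nCn minn].
have Cin x : C x -> exists2 k, x = inl (i, Some k) & k < n.
  case: x => [[j [k|]]|v] Cx.
  - have /= [ji _] := ubm _ Cx; rewrite ji in Cx *; exists k => //.
    by rewrite ltnNge; apply/negP => nk; apply: nCn; exact: C1 nk.
  - by have /= [ji _] := ubm _ Cx; case: nCn; apply: C2; rewrite -ji.
  - by have := ubm _ Cx.
have [k0 _] := Cin _ Cx0.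
case: n => [//|n] in nCn minn Cin * => _.
have Cn : C (inl (i, Some n)).
  by apply: contrapT => /asboolP/minn; rewrite ltnn.
apply: nCm; apply: comb_le_closed CC _ Cn.
by apply: lem => _ /Cin[k -> kn].
Qed.

(** * Irreducible sets in X and morphisms out of X *)

(** Irreducibility confines [F] below a single [s_i]. In both coverings used, the second closed set
    is not stable under suprema of chains, hence the flag [false]. *)
Lemma comb_top_not_irr_supremum (T : choiceType) (t : T)
    (F : set (comb false T)) :
  F `<=` range inl -> irreducible_set F -> ~ is_supremum F (inr t).
Proof.
move=> Finl [[x0 Fx0] irrF] [_ lem].
suff [p Fp] : exists p, F `<=` [set x | comb_le x (inl p)].
  have /specialization_comb // : specialization (inr t : comb false T) (inl p).
  by apply: lem => x /Fp ?; apply/specialization_comb.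
have [[i Fi]|nF] := pselect (exists i, F (inl (i, None))).
  exists (i, None).
  have [||x Fx|//|FD] := irrF [set x | comb_le x (inl (i, None))]
    [set x | range inl x /\ x <> inl (i, None)].
  - exact/closed_comb/comb_down_closed.
  - by apply/closed_comb; split=> // u [[]].
  - have [->|xi] := pselect (x = inl (i, None)); [by left|right].
    by split=> //; exact: Finl.
  - by have [] := FD _ Fi.
case: (Finl _ Fx0) (Fx0) => -[i [n|]] _ <- Fp; last by case: nF; exists i.
exists (i, None).
have [||x Fx|//|FD] := irrF [set x | comb_le x (inl (i, None))]
  [set x | exists j m, x = inl (j, Some m) /\ j <> i].
- exact/closed_comb/comb_down_closed.
- apply/closed_comb; split=> //.
  + by move=> j k [_ [_ [[<- _] ji]]] m mk; exists j, m.
  + by move=> j [? [? []]].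
  + by move=> /(_ 0)[j _ [? [? []]]].
  + by move=> u [? [? []]].
- case: (Finl _ Fx) (Fx) => -[j [m|]] _ <- Fjm; last by case: nF; exists j.
  have [->|/eqP ji] := eqVneq j i; first by left.
  by right; exists j, m.
- by have [_ [_ [[<- _] ]]] := FD _ Fp.
Qed.

(** The image of a chain is irreducible with supremum [f s_i], so its closure has a generic point
    [y] above [f s_i]. A closed set containing the image contains [y], hence [f s_i]. *)
Lemma preserves_irr_sup_continuous (T : choiceType) (Y : topologicalType)
    (f : comb false T -> Y) :
  kbounded_sober Y -> continuous f -> preserves_irr_sup f ->
  continuous (fun x : comb true T => f x).
Proof.
move=> [_ sobY] /continuous_closedP cf pf; apply/continuous_closedP => A cA.
apply/closed_comb; have /closed_comb[A1 A2 _ A4 A5] := cf _ cA.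
have {}A3 i : (forall n, A (f (inl (i, Some n)))) -> A (f (inl (i, None))).
  move=> An.
  have irri := tooth_irreducible (s := false) (T := T) i.
  have supi := tooth_supremum (s := false) (T := T) i.
  have [ubs _] := pf _ _ irri supi.
  set D := f @` _ in ubs.
  have irrD : irreducible_set D.
    apply: irreducible_image irri; exact/continuous_closedP.
  have [||y [Dy _]] := sobY _ (irreducible_closure irrD).
  - exact: closed_closure.
  - by exists (f (inl (i, None))); apply: is_supremum_closure; exact: pf.
  have [_ lesi] := pf _ _ irri supi.
  have : specialization (f (inl (i, None))) y.
    by apply: lesi => z Dz; rewrite /specialization -Dy; exact: subset_closure.
  apply: specialization_closed => //.
  suff : closure D `<=` A by apply; rewrite Dy; exact: subset_closure.
  rewrite [X in _ `<=` X](closure_id A).1//; apply: closureS.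
  by move=> _ [_ [n ->] <-].
by split.
Qed.

(** * The set of all chains with their suprema *)

(** One of two covering closed sets contains infinitely many [s_i], hence all chains, hence by
    stability every [s_i]. *)
Lemma comb_base_irreducible (T : choiceType) :
  irreducible_set (range inl : set (comb true T)).
Proof.
split; first by exists (inl (0, None)), (0, None).
move=> A B /closed_comb[_ _ A3 A4 _] /closed_comb[_ _ B3 B4 _] AB.
have [i|/A4 At|/B4 Bt] := @unboundedU [set i | A (inl (i, None))]
    [set i | B (inl (i, None))]; first by exists i => //; apply: AB; exists (i, None).
- by left=> _ [[i [n|]] _ <-] //; exact: A3.
- by right=> _ [[i [n|]] _ <-] //; exact: B3.
Qed.

Lemma comb_base_closed (s : bool) (T : choiceType) :
  closed (range inl : set (comb s T)).
Proof.
apply/closed_comb; split.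
- by move=> i n _ m _; exists (i, Some m).
- by move=> i _ n; exists (i, Some n).
- by move=> _ i _; exists (i, None).
- by move=> _ i n; exists (i, Some n).
- by move=> t [].
Qed.

(** * Maps between combs *)

Definition comb_map (s s' : bool) (S T : choiceType) (h : S -> T)
    (x : comb s S) : comb s' T :=
  match x with inl p => inl p | inr t => inr (h t) end.

Lemma comb_map_continuous (s s' : bool) (S T : choiceType) (h : S -> T) :
  s ==> s' -> continuous (comb_map (s := s) s' h).
Proof.
move=> /implyP ss; apply/continuous_closedP => A /closed_comb[A1 A2 A3 A4 A5].
by apply/closed_comb; split=> //; [move=> /ss; exact: A3|move=> t /A5].
Qed.

(** Only the supremum [inr tt] is delicate: an irreducible set having it must contain it, so every
    upper bound of the image is above [inr t]. *)
Lemma comb_inclusion_preserves_irr_sup (T : choiceType) (t : T) :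
  preserves_irr_sup (comb_map (s := false) true (fun _ : unit => t)).
Proof.
move=> F m irrF supF; have [ubm lem] := supF; split.
  move=> _ [x /ubm/specialization_comb xm <-]; apply/specialization_comb.
  by move: x m xm {ubm lem supF} => [p|u] [q|v].
move=> u ubu; apply/specialization_comb.
have {}ubu x : F x -> comb_le (comb_map true (fun=> t) x) u.
  by move=> Fx; apply/specialization_comb; apply: ubu; exists x.
case: u => [p|u] in ubu *.
  have /specialization_comb : specialization m (inl p).
    apply: lem => x Fx; apply/specialization_comb; have := ubu _ Fx.
    by case: x {Fx}.
  by case: m {ubm lem supF}.
case: m => [//|[]] in ubm lem supF *.
have [[[] Ft]|nF] := pselect (exists v, F (inr v)); first exact: (ubu _ Ft).
exfalso; apply: comb_top_not_irr_supremum irrF supF => -[p|v] Fx; first by exists p.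
by case: nF; exists v.
Qed.

(** * Refuting the reflection *)

Theorem proposition3p8 : ~ reflective KBSob_Topk.
Proof.
pose X : Topk := exist _ (comb false unit : topologicalType) comb_kolmogorov.
have sobZ : kbounded_sober (comb true (option bool)).
  by apply: comb_kbounded_sober => -[b|]; [exists None|exists (Some true)].
pose Z : KBSob := exist _ (comb true (option bool) : topologicalType) sobZ.
pose j : hom X (KBSob_Topk Z) := exist _ (comb_map true (fun=> None))
  (conj (@comb_map_continuous false true unit (option bool) (fun=> None) isT)
    (@comb_inclusion_preserves_irr_sup (option bool) None)).
pose swap : hom Z Z := exist _ (comb_map true (omap negb))
  (@comb_map_continuous true true _ _ (omap negb) isT).
move=> /(_ X)[Y [r univ]].
have [g [gr guniq]] := univ Z j.
have grE x : sval g (sval r x) = sval j x by rewrite -gr.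
have swapg : Defs.catcomp swap g = g.
  apply/esym/guniq; apply: sval_inj; apply/funext => x /=.
  by rewrite grE; case: x.
have [cr pr] := svalP r.
have rcont := preserves_irr_sup_continuous (svalP Y) cr pr.
pose pi : comb true (option bool) -> comb true unit := comb_map true (fun=> tt).
(* The points fixed by [swap] are the [inl p] and [inr None], which form the image of [j]. *)
have jpi y : comb_map true (fun=> None) (pi (sval g y)) = sval g y.
  have /= := congr1 (fun h : hom Y Z => sval h y) swapg.
  by case: (sval g y) => [//|[[]|]].
have rho_cont : continuous (fun y : sval Y => sval r (pi (sval g y))).
  have cpi := @comb_map_continuous true true (option bool) unit (fun=> tt) isT.
  move=> y; apply: (continuous_comp (f := pi \o sval g)); last exact: rcont.
  by apply: continuous_comp; [exact: (svalP g)|exact: cpi].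
pose rho : hom Y Y := exist _ _ rho_cont.
have rgK y : sval r (pi (sval g y)) = y.
  have [h [_ huniq]] := univ Y r.
  have rhoE : h = rho.
    apply: huniq; apply: sval_inj; apply/funext => x /=.
    by rewrite grE; case: x => [//|[]].
  have idE : h = idm Y by apply: huniq; exact: sval_inj.
  by have := congr1 (fun k : hom Y Y => sval k y) (etrans (esym rhoE) idE).
pose F : set (comb true unit) := range inl.
pose top : sval Y := sval r (inr tt).
pose C := closure (sval r @` F).
have irrC : irreducible_set C.
  apply: irreducible_closure.
  exact: (irreducible_image rcont (comb_base_irreducible unit)).
have supC : is_supremum C top.
  apply: is_supremum_closure; split=> [_ [_ [p _ <-] <-]|u ubu].
    apply: (@continuous_specialization (comb true unit) (sval Y) (sval r)
      (inl p) (inr tt) rcont).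
    exact/specialization_comb.
  case pgu : (pi (sval g u)) => [p|[]]; last first.
    by rewrite -(rgK u) pgu; exact: subset_closure.
  have gu : sval g u = inl p by rewrite -jpi pgu.
  (* The index [p.1.+1] selects a chain other than that of [p], so its supremum cannot lie below
     [inl p]. *)
  have : specialization (sval r (inl (p.1.+1, None))) u.
    by apply: ubu; exists (inl (p.1.+1, None)) => //; exists (p.1.+1, None).
  move=> /(continuous_specialization (svalP g)); rewrite grE gu.
  by move=> /specialization_comb[/= /esym/n_Sn].
have [|y [Cy _]] := (svalP Y).2 C irrC (@closed_closure _ _); first by exists top.
have Ctop : C top.
  rewrite Cy; apply: supC.2 => x; by rewrite Cy.
(* This closed preimage contains [C], yet [g] sends [top] to [inr None]. *)
have : (sval g @^-1` range inl) top.
  apply: (_ : C `<=` _) Ctop.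
  have /continuous_closedP/(_ _ (@comb_base_closed true _)) cg := svalP g.
  rewrite [X in _ `<=` X](closure_id _).1//; apply: closureS.
  by move=> _ [_ [p _ <-] <-]; rewrite /= grE; exists p.
by rewrite /= grE => -[].
Qed.
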